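(* Let $G=(Q,\Sigma,\delta,\widetilde{\Pi},\boldsymbol{\chi},\mathscr{C})$ be a finite state plant with unobservability map $\mathfrak{p}$. The (asymptotic) runtime complexity of the offline portion of the partial-observation control algorithm (described in the context) is the same as that of Algorithm A (described in the context), the algorithm computing the optimal supervisor under perfect observation.
   Context: **Plant.** A plant is a probabilistic finite state automaton $G=(Q,\Sigma,\delta,\widetilde{\Pi},\boldsymbol{\chi},\mathscr{C})$: $Q=\{q_1,\dots,q_n\}$ is a finite state set; $\Sigma$ a finite event alphabet; $\delta:Q\times\Sigma\to Q$ a (possibly partial) transition map; $\widetilde{\Pi}_{ij}=\tilde{\pi}(q_i,\sigma_j)\ge 0$ are event generation probabilities, zero where $\delta$ is undefined and with $\sum_j\widetilde{\Pi}_{ij}=1$; $\Pi_{ij}=\sum_{\sigma:\delta(q_i,\sigma)=q_j}\tilde{\pi}(q_i,\sigma)$ is the stochastic transition matrix; $\boldsymbol{\chi}\in[-1,1]^n$ is the vector of state characteristics; $\mathscr{C}$ is the set of controllable transitions. Disabling a controllable transition $q_i\xrightarrow{\sigma}q_j$ replaces it by a self-loop $\delta(q_i,\sigma)=q_i$ with the same occurrence probability. Complexity is measured in terms of the number $n$ of plant states. **Unobservability.** $\mathfrak{p}:Q\times\Sigma^\star\to\Sigma^\star$ satisfies $\mathfrak{p}(q,\sigma)=\epsilon$ if $\sigma$ is unobservable from $q$ and $\mathfrak{p}(q,\sigma)=\sigma$ otherwise, and $\mathfrak{p}(q,\sigma\omega)=\mathfrak{p}(q,\sigma)\mathfrak{p}(\delta(q,\sigma),\omega)$.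 Unobservable transitions are assumed uncontrollable. The phantom transition matrix is $\mathscr{P}(\Pi)_{ij}=\sum_{\sigma:\delta(q_i,\sigma)=q_j,\ \mathfrak{p}(q_i,\sigma)=\epsilon}\tilde{\pi}(q_i,\sigma)$. **Transition matrices.** With $\theta=\theta_{min}$ (defined below), for $\sigma\in\Sigma$, $\Gamma^\sigma$ is the $n\times n$ matrix whose $i$-th row is zero if $\delta(q_i,\sigma)$ is undefined or $\mathfrak{p}(q_i,\sigma)=\epsilon$, and otherwise equals the $r$-th row of $[\mathbb{I}-(1-\theta)\mathscr{P}(\Pi)]^{-1}$, where $q_r=\delta(q_i,\sigma)$. The disabled transition matrix is $(\Gamma^\sigma_{\mathscr{D}})_{ij}=\delta_{ij}$ (Kronecker delta) if $\sigma$ is controllable at $q_i$ and $\mathfrak{p}(q_i,\sigma)=\sigma$, and $(\Gamma^\sigma_{\mathscr{D}})_{ij}=\Gamma^\sigma_{ij}$ otherwise. **Algorithm A (optimal supervision under perfect observation).** Start with $\mathscr{D}^{[0]}=\emptyset$, $\Pi^{[0]}=\Pi$, $k=1$. At step $k$ compute $\theta_\star^{[k]}$ from $P=\Pi^{[k-1]}$ by Algorithm B; set $\boldsymbol{\nu}^{[k]}=\theta_\star^{[k]}[\mathbb{I}-(1-\theta_\star^{[k]})\Pi^{[k-1]}]^{-1}\boldsymbol{\chi}$; disable all controllable $q_i\xrightarrow{\sigma}q_j$ with $\boldsymbol{\nu}^{[k]}_j<\boldsymbol{\nu}^{[k]}_i$ and enable all controllable ones with $\boldsymbol{\nu}^{[k]}_j\ge\boldsymbol{\nu}^{[k]}_i$;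 let $\mathscr{D}^{[k]}$ be the disabled set and $\Pi^{[k]}$ the resulting transition matrix. Stop if $\mathscr{D}^{[k]}=\mathscr{D}^{[k-1]}$, else increase $k$. The final set is $\mathscr{D}^\star$ and the final matrix is $\Pi^\star$. Put $\theta_{min}=\min_k\theta_\star^{[k]}$ and $\boldsymbol{\nu}_\star=\theta_{min}[\mathbb{I}-(1-\theta_{min})\Pi^\star]^{-1}\boldsymbol{\chi}$. **Algorithm B** (critical termination probability of a stochastic matrix $P$). Let $C=\lim_k\frac1k\sum_{j=0}^{k-1}P^j$, $M_0=[\mathbb{I}-P+C]^{-1}$, $M_1=\mathbb{I}-M_0$, $M_2=\inf_{\alpha\ne0}\|[\mathbb{I}-P+\alpha C]^{-1}\|_\infty$. For each pair $(i,j)$: if $(C\boldsymbol{\chi})_i\neq(C\boldsymbol{\chi})_j$ let $\theta_{ij}=|(C\boldsymbol{\chi})_i-(C\boldsymbol{\chi})_j|/(8M_2)$; otherwise let $r\in\{0,\dots,n\}$ be the least index with $(M_0M_1^r\boldsymbol{\chi})_i\ne(M_0M_1^r\boldsymbol{\chi})_j$, and let $\theta_{ij}=|((M_0-C)\boldsymbol{\chi})_i-((M_0-C)\boldsymbol{\chi})_j|/(8M_2)$ if $r=0$, $\theta_{ij}=|(M_0M_1^r\boldsymbol{\chi})_i-(M_0M_1^r\boldsymbol{\chi})_j|/(2^{r+3}M_2)$ if $r>0$, and $\theta_{ij}=1$ if no such $r$ exists. Output $\theta_\star=\min(1,\min_{i,j}\theta_{ij})$. **Offline portion of the partial-observation control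 algorithm.** Compute $\boldsymbol{\nu}_\star$ (by executing Algorithm A); set $\theta=\theta_{min}$; compute $M=[\mathbb{I}-(1-\theta_{min})\mathscr{P}(\Pi)]^{-1}$; for every $\sigma\in\Sigma$ compute $\Gamma^\sigma$, $\Gamma^\sigma_{\mathscr{D}}$ and $T^\sigma=[\Gamma^\sigma-\Gamma^\sigma_{\mathscr{D}}]\boldsymbol{\nu}_\star$; initialize $\alpha_0$ as the standard basis vector of $\mathbb{R}^n$ corresponding to the initial state and compute $\alpha=\alpha_0M$. *)

(* Defs.v *)
From HB Require Import structures.
From mathcomp Require Import all_boot all_order all_algebra.
From mathcomp Require Import all_classical all_reals all_analysis.

Set Implicit Arguments.
Unset Strict Implicit.
Unset Printing Implicit Defensive.

Import Order.TTheory GRing.Theory Num.Theory.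
Import numFieldNormedType.Exports.

Local Open Scope classical_set_scope.
Local Open Scope ring_scope.

(* The states are q_0, ..., q_{n-1}; [delta] is partial.  A controllable
   transition q -s-> delta(q, s) is named by the pair (q, s). *)
Record plant (R : realType) (Sigma : finType) (n : nat) := Plant {
  delta : 'I_n -> Sigma -> option 'I_n;
  ptilde : 'I_n -> Sigma -> R;
  chi : 'cV[R]_n;
  ctrl : {set 'I_n * Sigma};
  ptilde_ge0 : forall q s, 0 <= ptilde q s;
  ptilde_undef : forall q s, delta q s = None -> ptilde q s = 0;
  ptilde_sum1 : forall q, \sum_s ptilde q s = 1;
  chi_bounded : forall q, -1 <= chi q 0 <= 1;
  ctrl_defined : forall q s, (q, s) \in ctrl -> delta q s != None
}.

Record unobservability (R : realType) (Sigma : finType) (n : nat)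
    (G : plant R Sigma n) := Unobservability {
  unobs : 'I_n -> Sigma -> bool;
  unobs_unctrl : forall q s, unobs q s -> (q, s) \notin ctrl G
}.

(* The map p : Q x Sigma^* -> Sigma^*.  A word is read up to its first
   undefined transition, so that the recursion makes sense for partial delta. *)
Fixpoint proj (R : realType) (Sigma : finType) (n : nat)
    (G : plant R Sigma n) (U : unobservability G) (q : 'I_n) (w : seq Sigma) :
    seq Sigma :=
  if w is s :: w' then
    (if unobs U q s then [::] else [:: s]) ++
    (if delta G q s is Some q' then proj U q' w' else [::])
  else [::].

(* A terminating real-RAM computation: its result and the number of elementary
   operations (arithmetic, comparison, table look-up, store) it performs. *)
Definition timed (T : Type) : Type := (T * nat)%type.

Definition ret {T : Type} (x : T) : timed T := (x, 0%N).
Definition step {T : Type} (x : T) : timed T := (x, 1%N).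
Definition bind {S T : Type} (m : timed S) (f : S -> timed T) : timed T :=
  ((f m.1).1, (m.2 + (f m.1).2)%N).

Notation "'do' x <- m ; k" := (bind m (fun x => k))
  (at level 200, x name, m at level 100, k at level 200,
   format "'[v' 'do'  x  <-  m ;  '/' k ']'").

(* Loops: one further operation (store, addition or comparison) per turn. *)
Definition tab_mx {R : realType} {m n : nat} (f : 'I_m -> 'I_n -> timed R) :
    timed 'M[R]_(m, n) :=
  (\matrix_(i, j) (f i j).1, (\sum_i \sum_j ((f i j).2 + 1))%N).

Definition tab_fun {I : finType} {T : Type} (f : I -> timed T) :
    timed (I -> T) :=
  (fun i => (f i).1, (\sum_i ((f i).2 + 1))%N).

Definition tab_set {I : finType} (f : I -> timed bool) : timed {set I} :=
  ([set i | (f i).1]%SET, (\sum_i ((f i).2 + 1))%N).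

Definition sum_loop {R : realType} {I : finType} (f : I -> timed R) : timed R :=
  (\sum_i (f i).1, (\sum_i ((f i).2 + 1))%N).

Definition min_loop {R : realType} {I : finType} (x : R) (f : I -> timed R) :
    timed R :=
  (\big[Num.min/x]_i (f i).1, (\sum_i ((f i).2 + 1))%N).

Definition eq_set {I : finType} (A B : {set I}) : timed bool :=
  (A == B, #|I|).

Fixpoint find_loop {T : Type} (p : T -> timed bool) (s : seq T) : timed nat :=
  if s is x :: s' then
    do b <- p x; if b then ret 0%N else do k <- find_loop p s'; step k.+1
  else ret 0%N.

Fixpoint pow {R : realType} (x : R) (k : nat) : timed R :=
  if k is k'.+1 then do y <- pow x k'; step (x * y) else ret 1.

Definition add_mx {R : realType} {m n} (A B : 'M[R]_(m, n)) :=
  tab_mx (fun i j => step (A i j + B i j)).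
Definition sub_mx {R : realType} {m n} (A B : 'M[R]_(m, n)) :=
  tab_mx (fun i j => step (A i j - B i j)).
Definition scale_mx {R : realType} {m n} (a : R) (A : 'M[R]_(m, n)) :=
  tab_mx (fun i j => step (a * A i j)).
Definition mul_mx {R : realType} {m n p}
    (A : 'M[R]_(m, n)) (B : 'M[R]_(n, p)) :=
  tab_mx (fun i j => sum_loop (fun k => step (A i k * B k j))).

Definition cesaro_limit {R : realType} {n : nat} (P : 'M[R]_n) : 'M[R]_n :=
  lim ((fun k : nat => k%:R^-1 *: \sum_(j < k) P ^+ j) @ \oo).

(* The operator norm induced by the sup norm (not the entrywise maximum). *)
Definition norm_inf {R : realType} {n : nat} (A : 'M[R]_n) : R :=
  \big[Num.max/0]_i \sum_j `|A i j|.

Definition inf_norm_inv {R : realType} {n : nat} (P C : 'M[R]_n) : R :=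
  inf [set norm_inf (invmx (1%:M - P + a *: C)) | a in [set a : R | a != 0]].

(* No method is prescribed for inverting a matrix or for finding the limit C
   and the infimum M_2, so the operation counts of these subroutines are
   arbitrary; that of inversion depends on the dimension alone. *)
Record cost_model (R : realType) := CostModel {
  inv_cost : nat -> nat;
  cesaro_cost : forall n, 'M[R]_n -> nat;
  inf_norm_cost : forall n, 'M[R]_n -> 'M[R]_n -> nat
}.

Definition inv_mx {R : realType} (cm : cost_model R) {n} (A : 'M[R]_n) :
    timed 'M[R]_n := (invmx A, inv_cost cm n).
Definition cesaro {R : realType} (cm : cost_model R) {n} (P : 'M[R]_n) :
    timed 'M[R]_n := (cesaro_limit P, cesaro_cost cm P).
Definition inf_norm {R : realType} (cm : cost_model R) {n} (P C : 'M[R]_n) :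
    timed R := (inf_norm_inv P C, inf_norm_cost cm P C).

(* [I - (1 - theta) P]^-1 *)
Definition resolvent {R : realType} (cm : cost_model R) {n}
    (theta : R) (P : 'M[R]_n) : timed 'M[R]_n :=
  do a <- step (1 - theta);
  do aP <- scale_mx a P;
  do B <- sub_mx 1%:M aP;
  inv_mx cm B.

(* theta [I - (1 - theta) P]^-1 chi *)
Definition measure_vec {R : realType} (cm : cost_model R) {n}
    (theta : R) (P : 'M[R]_n) (x : 'cV[R]_n) : timed 'cV[R]_n :=
  do Z <- resolvent cm theta P;
  do y <- mul_mx Z x;
  scale_mx theta y.

(* [:: M0 u; M0 M1 u; ...; M0 M1^(k-1) u] *)
Fixpoint moments {R : realType} {n} (M0 M1 : 'M[R]_n) (u : 'cV[R]_n) (k : nat) :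
    timed (seq 'cV[R]_n) :=
  if k is k'.+1 then
    do v <- mul_mx M0 u;
    do u' <- mul_mx M1 u;
    do vs <- moments M0 M1 u' k';
    step (v :: vs)
  else ret [::].

Definition gap {R : realType} (x y d : R) : timed R :=
  do a <- step (x - y);
  do b <- step `|a|;
  step (b / d).

(* [Cx] = C chi, [Ex] = (M0 - C) chi and [vs] lists M0 M1^r chi, 0 <= r <= n. *)
Definition theta_pair {R : realType} {n} (M2 : R) (Cx Ex : 'cV[R]_n)
    (vs : seq 'cV[R]_n) (i j : 'I_n) : timed R :=
  do b <- step (Cx i 0 != Cx j 0);
  if b then do d <- step (8 * M2); gap (Cx i 0) (Cx j 0) d
  else
    do r <- find_loop (fun v : 'cV[R]_n => step (v i 0 != v j 0)) vs;
    do found <- step (r < size vs)%N;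
    if ~~ found then ret 1
    else
      do r0 <- step (r == 0%N);
      if r0 then do d <- step (8 * M2); gap (Ex i 0) (Ex j 0) d
      else
        do r3 <- step (r + 3)%N;
        do w <- pow 2 r3;
        do d <- step (w * M2);
        gap (nth 0 vs r i 0) (nth 0 vs r j 0) d.

Definition algorithm_B {R : realType} (cm : cost_model R) {n}
    (x : 'cV[R]_n) (P : 'M[R]_n) : timed R :=
  do C <- cesaro cm P;
  do IP <- sub_mx 1%:M P;
  do IPC <- add_mx IP C;
  do M0 <- inv_mx cm IPC;
  do M1 <- sub_mx 1%:M M0;
  do M2 <- inf_norm cm P C;
  do Cx <- mul_mx C x;
  do E <- sub_mx M0 C;
  do Ex <- mul_mx E x;
  do vs <- moments M0 M1 x n.+1;
  min_loop 1 (fun ij : 'I_n * 'I_n => theta_pair M2 Cx Ex vs ij.1 ij.2).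

(* [p x t]: the program p halts with result x after t operations. *)
Definition prog (T : Type) : Type := T -> nat -> Prop.

Definition halting {T : Type} (m : timed T) : prog T := fun x t => m = (x, t).

Definition pbind {S T : Type} (p : prog S) (f : S -> prog T) : prog T :=
  fun y t => exists x t1 t2, [/\ p x t1, f x y t2 & t = (t1 + t2)%N].

Inductive repeat_until {S : Type} (body : S -> timed (S * bool)) :
    S -> prog S :=
| RepeatStop s s' t :
    body s = ((s', true), t) -> repeat_until body s s' t
| RepeatNext s s' s'' t t' :
    body s = ((s', false), t) -> repeat_until body s' s'' t' ->
    repeat_until body s s'' (t + t')%N.

(* Programs are deterministic: the infimum is over at most one number, and is
   +oo exactly when the program does not halt. *)
Definition runtime (R : realType) {T : Type} (p : prog T) : \bar R :=
  ereal_inf [set (t%:R)%:E | t in [set t | exists x, p x t]].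

Section AlgorithmA.
Variables (R : realType) (Sigma : finType) (cm : cost_model R) (n : nat).
Variable G : plant R Sigma n.

(* Transition matrix once the transitions in D are replaced by self-loops. *)
Definition transition_matrix (D : {set 'I_n * Sigma}) : timed 'M[R]_n :=
  tab_mx (fun i j => sum_loop (fun s =>
    do d <- step ((i, s) \in D);
    do o <- (if d then step (Some i) else step (delta G i s));
    do b <- step (o == Some j);
    ret (if b then ptilde G i s else 0))).

Definition disabled_set (nu : 'cV[R]_n) : timed {set 'I_n * Sigma} :=
  tab_set (fun qs : 'I_n * Sigma =>
    do c <- step (qs \in ctrl G);
    if c then
      do o <- step (delta G qs.1 qs.2);
      if o is Some j then step (nu j 0 < nu qs.1 0) else ret false
    else ret false).

(* D^[k], Pi^[k], and the minimum of theta_*^[1], ..., theta_*^[k]. *)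
Record stateA := StateA {
  curD : {set 'I_n * Sigma};
  curPi : 'M[R]_n;
  curtheta : R
}.

(* The running minimum starts at 1, an upper bound of every theta_*. *)
Definition initA : timed stateA :=
  do P <- transition_matrix finset.set0;
  ret (StateA finset.set0 P 1).

Definition roundA (st : stateA) : timed (stateA * bool) :=
  do theta <- algorithm_B cm (chi G) (curPi st);
  do nu <- measure_vec cm theta (curPi st) (chi G);
  do D <- disabled_set nu;
  do P <- transition_matrix D;
  do theta_min <- step (Num.min (curtheta st) theta);
  do halt <- eq_set D (curD st);
  ret (StateA D P theta_min, halt).

Record outputA := OutputA {
  Dstar : {set 'I_n * Sigma};
  Pistar : 'M[R]_n;
  theta_min : R;
  nustar : 'cV[R]_n
}.

Definition finishA (st : stateA) : timed outputA :=
  do nu <- measure_vec cm (curtheta st) (curPi st) (chi G);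
  ret (OutputA (curD st) (curPi st) (curtheta st) nu).

Definition algorithm_A : prog outputA :=
  pbind (halting initA) (fun st0 =>
  pbind (repeat_until roundA st0) (fun st =>
  halting (finishA st))).

End AlgorithmA.

Section Offline.
Variables (R : realType) (Sigma : finType) (cm : cost_model R) (n : nat).
Variables (G : plant R Sigma n) (U : unobservability G) (q0 : 'I_n).

Definition phantom_matrix : timed 'M[R]_n :=
  tab_mx (fun i j => sum_loop (fun s =>
    do o <- step (delta G i s);
    do b <- step (o == Some j);
    do u <- step (proj U i [:: s] == [::]);
    ret (if b && u then ptilde G i s else 0))).

Definition gamma (M : 'M[R]_n) (s : Sigma) : timed 'M[R]_n :=
  tab_mx (fun i j =>
    do u <- step (proj U i [:: s] == [::]);
    do o <- step (delta G i s);
    if u then ret 0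
    else if o is Some r then ret (M r j) else ret 0).

Definition gammaD (Gs : 'M[R]_n) (s : Sigma) : timed 'M[R]_n :=
  tab_mx (fun i j =>
    do c <- step ((i, s) \in ctrl G);
    do o <- step (proj U i [:: s] == [:: s]);
    if c && o then step (i == j)%:R else ret (Gs i j)).

Record event_data := EventData {
  Gamma : 'M[R]_n;
  GammaD : 'M[R]_n;
  Tvec : 'cV[R]_n
}.

Definition event_tables (M : 'M[R]_n) (nu : 'cV[R]_n) (s : Sigma) :
    timed event_data :=
  do Gs <- gamma M s;
  do GDs <- gammaD Gs s;
  do E <- sub_mx Gs GDs;
  do T <- mul_mx E nu;
  ret (EventData Gs GDs T).

Record output_offline := OutputOffline {
  supervisor : outputA R Sigma n;
  Mphantom : 'M[R]_n;
  tables : Sigma -> event_data;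
  alpha : 'rV[R]_n
}.

Definition offline_rest (A : outputA R Sigma n) : timed output_offline :=
  do P <- phantom_matrix;
  do M <- resolvent cm (theta_min A) P;
  do tb <- tab_fun (event_tables M (nustar A));
  do alpha0 <- tab_mx (fun (_ : 'I_1) j => step (j == q0)%:R);
  do al <- mul_mx alpha0 M;
  ret (OutputOffline A M tb al).

Definition offline : prog output_offline :=
  pbind (algorithm_A cm G) (fun A => halting (offline_rest A)).

End Offline.

Local Open Scope ereal_scope.

Definition worst_A (R : realType) (Sigma : finType) (cm : cost_model R)
    (n : nat) : \bar R :=
  ereal_sup [set t | exists G : plant R Sigma n,
    t = runtime R (algorithm_A cm G)].

Definition worst_offline (R : realType) (Sigma : finType) (cm : cost_model R)
    (n : nat) : \bar R :=
  ereal_sup [set t | exists (G : plant R Sigma n) (U : unobservability G)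
    (q0 : 'I_n), t = runtime R (offline cm U q0)].

(* Main.v *)
Require Import Defs.
From mathcomp Require Import all_boot all_order all_algebra.
From mathcomp Require Import all_classical all_reals all_analysis.
From mathcomp Require Import zify.

Import Order.TTheory GRing.Theory Num.Theory.
Import numFieldNormedType.Exports.

Local Open Scope classical_set_scope.
Local Open Scope ring_scope.
Local Open Scope ereal_scope.

(** The offline portion runs Algorithm A and then performs a single inversion
    of an n x n matrix plus O(|Sigma| n^2) operations.  Algorithm A itself ends
    by computing nu_*, hence by forming and inverting an n x n matrix, which
    already costs 4 n^2 + 1 operations plus one inversion.  As Sigma is fixed,
    the extra work is absorbed by a constant factor; if Algorithm A does not
    halt, both runtimes are +oo. *)

Section Costs.
#[local] Set Implicit Arguments.
#[local] Unset Strict Implicit.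
Variables (R : realType) (Sigma : finType) (cm : cost_model R).
Local Open Scope nat_scope.

Lemma tab_mx_cost_le m n (f : 'I_m -> 'I_n -> timed R) c :
  (forall i j, (f i j).2 <= c) -> (tab_mx f).2 <= m * (n * c.+1).
Proof.
move=> fc; rewrite /tab_mx /=.
rewrite -[m in leqRHS]card_ord -[n in leqRHS]card_ord -!sum_nat_const.
by apply: leq_sum => i _; apply: leq_sum => j _; rewrite addn1 ltnS.
Qed.

Lemma tab_mx_cost m n (f : 'I_m -> 'I_n -> timed R) c :
  (forall i j, (f i j).2 = c) -> (tab_mx f).2 = m * (n * c.+1).
Proof.
move=> fc; rewrite /tab_mx /=.
rewrite -[m in RHS]card_ord -[n in RHS]card_ord -!sum_nat_const.
by apply: eq_bigr => i _; apply: eq_bigr => j _; rewrite fc addn1.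
Qed.

Lemma sum_loop_cost (I : finType) (f : I -> timed R) c :
  (forall i, (f i).2 = c) -> (sum_loop f).2 = #|I| * c.+1.
Proof.
move=> fc; rewrite /sum_loop /= -sum_nat_const.
by apply: eq_bigr => i _; rewrite fc addn1.
Qed.

Lemma tab_fun_cost_le (I : finType) T (f : I -> timed T) c :
  (forall i, (f i).2 <= c) -> (tab_fun f).2 <= #|I| * c.+1.
Proof.
move=> fc; rewrite /tab_fun /= -sum_nat_const.
by apply: leq_sum => i _; rewrite addn1 ltnS.
Qed.

Lemma mul_mx_cost m n p (A : 'M[R]_(m, n)) (B : 'M[R]_(n, p)) :
  (mul_mx A B).2 = m * (p * (n * 2).+1).
Proof.
apply: tab_mx_cost => i j.
by rewrite -[n in RHS]card_ord; exact: sum_loop_cost.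
Qed.

Lemma sub_mx_cost m n (A B : 'M[R]_(m, n)) : (sub_mx A B).2 = m * (n * 2).
Proof. exact: tab_mx_cost. Qed.

Lemma scale_mx_cost m n a (A : 'M[R]_(m, n)) : (scale_mx a A).2 = m * (n * 2).
Proof. exact: tab_mx_cost. Qed.

Lemma bind_cost S T (m : timed S) (f : S -> timed T) :
  (bind m f).2 = m.2 + (f m.1).2.
Proof. by []. Qed.

(** The count depends on neither [theta] nor [P], so the inversion for the phantom matrix costs
    exactly as much as the one for [nustar]. *)
Lemma resolvent_cost n theta (P : 'M[R]_n) :
  (resolvent cm theta P).2 = 4 * n ^ 2 + 1 + inv_cost cm n.
Proof.
rewrite /resolvent !bind_cost sub_mx_cost scale_mx_cost [(step _).2]/=.
rewrite [(inv_mx _ _).2]/=; lia.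
Qed.

Variables (n : nat) (G : plant R Sigma n) (U : unobservability G).

Lemma phantom_matrix_cost :
  (phantom_matrix U).2 = n * (n * (#|Sigma| * 4).+1).
Proof. by apply: tab_mx_cost => i j; exact: sum_loop_cost. Qed.

Lemma gamma_cost M s : (gamma U M s).2 = n * (n * 3).
Proof. by apply: tab_mx_cost => i j; rewrite /=; case: ifP; case: delta. Qed.

Lemma gammaD_cost_le M s : (gammaD U M s).2 <= n * (n * 4).
Proof. by apply: tab_mx_cost_le => i j; rewrite /=; case: ifP. Qed.

Lemma event_tables_cost_le M nu s :
  0 < n -> (event_tables U M nu s).2 <= 12 * n ^ 2.
Proof.
move=> n0; rewrite /event_tables !bind_cost.
rewrite gamma_cost sub_mx_cost mul_mx_cost [(ret _).2]/=.
have := gammaD_cost_le (gamma U M s).1 s; nia.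
Qed.

(** With s events, the phantom matrix costs (4s + 1) n^2, the event tables at most 13 s n^2, and the
    resolvent 4 n^2 + 1 plus one inversion. The initial row vector and its product with M add 2 n^2
    + 3 n, at most 5 n^2. *)
Lemma offline_rest_cost_le (q0 : 'I_n) A :
  (offline_rest cm U q0 A).2
    <= (17 * #|Sigma| + 10) * n ^ 2 + 1 + inv_cost cm n.
Proof.
have n0 : 0 < n by case: q0 => i; exact: leq_ltn_trans.
rewrite /offline_rest bind_cost phantom_matrix_cost bind_cost resolvent_cost.
rewrite !bind_cost mul_mx_cost [(ret _).2]/= (@tab_mx_cost _ _ _ 1) //.
set M := (resolvent _ _ _).1.
have := @tab_fun_cost_le _ _ (event_tables U M (nustar A)) _
  (fun s => event_tables_cost_le M (nustar A) s n0).
move: (tab_fun _).2 => t tle.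
have {}tle : t <= #|Sigma| * (13 * n ^ 2).
  by apply: leq_trans tle _; rewrite leq_mul2l; apply/orP; right; nia.
have : n <= n ^ 2 by nia.
rewrite -mulnn in tle *; nia.
Qed.

(** Only the resolvent formed in [finishA] is counted; the initialization and all rounds are
    discarded. *)
Lemma algorithm_A_cost_ge out t :
  algorithm_A cm G out t -> 4 * n ^ 2 + 1 + inv_cost cm n <= t.
Proof.
move=> [st0 [t0 [t' [_ [st [t1 [t2 [_ fin ->]]]] ->]]]].
have -> : t2 = (finishA cm G st).2 by rewrite fin.
rewrite /finishA bind_cost /measure_vec bind_cost resolvent_cost.
by do 2!apply: leq_trans (leq_addl _ _); rewrite -[leqRHS]addnA leq_addr.
Qed.

End Costs.

Section Runtime.
#[local] Set Implicit Arguments.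
#[local] Unset Strict Implicit.
Variable R : realType.

Lemma runtime_le T (p : prog T) x t : p x t -> runtime R p <= (t%:R)%:E.
Proof. by move=> pxt; apply: ereal_inf_lbound; exists t => //; exists x. Qed.

(** For a program that does not halt, the premise is vacuous and the infimum over the empty set is
    +oo. *)
Lemma le_runtime T (p : prog T) (y : \bar R) :
  (forall x t, p x t -> y <= (t%:R)%:E) -> y <= runtime R p.
Proof. by move=> yp; apply: le_ereal_inf_tmp => _ [t [x pxt] <-]; exact: yp pxt. Qed.

Lemma runtime_pbind_ge S T (p : prog S) (f : S -> prog T) :
  runtime R p <= runtime R (pbind p f).
Proof.
apply: le_runtime => _ _ [x [t1 [t2 [px _ ->]]]].
by apply: le_trans (runtime_le px) _; rewrite lee_fin ler_nat leq_addr.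
Qed.

Lemma runtime_pbind_halting_le S T (p : prog S) (f : S -> timed T) (c : nat) :
  (forall x t, p x t -> (t + (f x).2 <= c.+1 * t)%N) ->
  runtime R (pbind p (fun x => halting (f x))) <= (c.+1%:R)%:E * runtime R p.
Proof.
move=> fc; rewrite -lee_pdivrMl ?ltr0n//.
apply: le_runtime => x t pxt; rewrite lee_pdivrMl ?ltr0n//.
have bt : pbind p (fun x => halting (f x)) (f x).1 (t + (f x).2)%N.
  by exists x, t, (f x).2; split=> //; rewrite /halting -surjective_pairing.
apply: le_trans (runtime_le bt) _.
by rewrite -EFinM lee_fin -natrM ler_nat; exact: fc.
Qed.

End Runtime.

Lemma runtime_offline_bounds (R : realType) (Sigma : finType)
    (cm : cost_model R) n (G : plant R Sigma n) (U : unobservability G)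
    (q0 : 'I_n) :
  runtime R (algorithm_A cm G) <= runtime R (offline cm U q0)
    <= ((17 * #|Sigma| + 10).+1%:R)%:E * runtime R (algorithm_A cm G).
Proof.
rewrite runtime_pbind_ge; apply: runtime_pbind_halting_le => A t runA.
have := @algorithm_A_cost_ge _ _ _ _ _ _ _ runA.
have := @offline_rest_cost_le _ _ cm _ _ U q0 A.
(* The factor 17 s + 10, being at least 1, also absorbs the summand 1 and the inversion. *)
move: (offline_rest _ _ _ _).2 => r; nia.
Qed.

Theorem proposition4p8 (R : realType) (Sigma : finType) (cm : cost_model R) :
  exists c1 c2 : R, [/\ (0 < c1)%R, (0 < c2)%R &
    \forall n \near \oo,
      (forall (G : plant R Sigma n) (U : unobservability G) (q0 : 'I_n),
         c1%:E * runtime R (algorithm_A cm G) <= runtime R (offline cm U q0)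
           <= c2%:E * runtime R (algorithm_A cm G)) /\
      c1%:E * worst_A Sigma cm n <= worst_offline Sigma cm n
        <= c2%:E * worst_A Sigma cm n].
Proof.
exists 1%R, (17 * #|Sigma| + 10).+1%:R; split; [by []|by rewrite ltr0n|].
near=> n; rewrite mul1e; split=> [G U q0|].
  by rewrite mul1e; exact: runtime_offline_bounds.
(* [worst_A] involves no initial state, whereas [worst_offline] needs one to exist. *)
have n0 : (0 < n)%N by near: n; exact: nbhs_infty_gt.
apply/andP; split.
  apply: ge_ereal_sup => _ [G ->].
  (* Any unobservability map would serve; making every event observable satisfies its condition
     vacuously. *)
  pose U : unobservability G :=
    @Unobservability _ _ _ G (fun _ _ => false) (fun _ _ => ltac:(done)).
  have /andP[+ _] := runtime_offline_bounds _ _ cm _ _ U (Ordinal n0).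
  move=> /le_trans; apply; apply: ereal_sup_ubound.
  by exists G, U, (Ordinal n0).
apply: ge_ereal_sup => _ [G [U [q0 ->]]].
have /andP[_ /le_trans] := runtime_offline_bounds _ _ cm _ _ U q0; apply.
(* The constant is positive and finite, so it cancels even if the worst case is +oo. *)
rewrite lee_pmul2l ?fin_numE// ?lte_fin ?ltr0n//.
by apply: ereal_sup_ubound; exists G.
Unshelve. all: by end_near.
Qed.
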